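(* Let $E$ be a nontrivial (i.e. $E\neq\{0\}$) Archimedean real vector lattice, let $n\in\mathbb{N}$, let $h\in\mathcal{H}(\mathbb{R}^n)$ be symmetric, and assume that $E$ is $h$-complete. Then the following are equivalent. (i) $h(f_1,\dots,f_n)=\bigvee_{k=1}^n f_k$ whenever $f_1,\dots,f_n\in E^+$ are pairwise disjoint, i.e. $f_i\wedge f_j=0$ for all $i,j\in\{1,\dots,n\}$ with $i\neq j$. (ii) $h(\underbrace{0,\dots,0}_{n-1\text{ copies}},f)=f$ holds for all $f\in E^+$.
   Context: $\mathbb{N}$ is the set of strictly positive integers, and $E^+$ is the positive cone of $E$. $\mathcal{H}(\mathbb{R}^n)$ is the space of continuous functions $h\colon\mathbb{R}^n\to\mathbb{R}$ that are positively homogeneous, i.e. $h(\lambda x)=\lambda h(x)$ for all real $\lambda\geq 0$ and $x\in\mathbb{R}^n$; $h$ is symmetric if its value is unchanged under every permutation of its arguments. For $f_1,\dots,f_n,g\in E$ and $h\in\mathcal{H}(\mathbb{R}^n)$, one writes $h(f_1,\dots,f_n)=g$ when $h(\omega(f_1),\dots,\omega(f_n))=\omega(g)$ holds for every nonzero real-valued vector lattice homomorphism $\omega$ defined on the vector sublattice of $E$ generated by $\{f_1,\dots,f_n,g\}$ (such a $g$ is unique if it exists). $E$ is called $h$-complete if for all $f_1,\dots,f_n\in E$ there exists $g\in E$ with $h(f_1,\dots,f_n)=g$; this yields a function $h\colon E^n\to E$, which is the one appearing in (i) and (ii). *)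

(* Defs.v *)
From HB Require Import structures.
From mathcomp Require Import all_boot all_order all_algebra fingroup perm.
From mathcomp Require Import boolp classical_sets reals topology normedtype.
Import Order.TTheory GRing.Theory Num.Theory.
Import numFieldNormedType.Exports.

Set Implicit Arguments.
Unset Strict Implicit.
Unset Printing Implicit Defensive.

Local Open Scope classical_set_scope.
Local Open Scope ring_scope.

(* Order.Lattice cannot be joined with GRing.Lmodule here: the hierarchy already
   joins additive structures and lattices at Num.RealDomain, which is totally
   ordered.  Hence the lattice operations are fields of the mixin. *)
HB.mixin Record isVectorLattice (R : realType) E
    of GRing.Lmodule R E & Num.POrderedZmodule E := {
  vjoin : E -> E -> E ;
  vmeet : E -> E -> E ;
  vleUx : forall x y z : E, (vjoin x y <= z) = (x <= z) && (y <= z) ;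
  vlexI : forall x y z : E, (z <= vmeet x y) = (z <= x) && (z <= y) ;
  vlerD2r : forall x y z : E, x <= y -> x + z <= y + z ;
  vlerZ : forall (a : R) (x y : E), 0 <= a -> x <= y -> a *: x <= a *: y
}.

#[short(type="vectorLatticeType")]
HB.structure Definition VectorLattice (R : realType) :=
  { E of GRing.Lmodule R E & Num.POrderedZmodule E & isVectorLattice R E }.

Section VectorLatticeDefs.
Context {R : realType} {E : vectorLatticeType R}.
Implicit Types (S : set E) (w : E -> R).

Definition is_vector_sublattice S :=
  [/\ S 0,
      (forall x y, S x -> S y -> S (x + y)),
      (forall a x, S x -> S (a *: x)),
      (forall x y, S x -> S y -> S (vjoin x y)) &
      (forall x y, S x -> S y -> S (vmeet x y))].

Definition generated_sublattice (A : set E) : set E :=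
  smallest is_vector_sublattice A.

(* A homomorphism defined on S is represented by a total function of which
   only the values on S are ever used. *)
Definition is_vl_hom_on S w :=
  [/\ (forall x y, S x -> S y -> w (x + y) = w x + w y),
      (forall a x, S x -> w (a *: x) = a * w x),
      (forall x y, S x -> S y -> w (vjoin x y) = Num.max (w x) (w y)) &
      (forall x y, S x -> S y -> w (vmeet x y) = Num.min (w x) (w y))].

Definition nonzero_on S w := exists2 x, S x & w x != 0.

End VectorLatticeDefs.

Definition archimedean_vl (R : realType) (E : vectorLatticeType R) :=
  forall x y : E, 0 <= x -> (forall k : nat, x *+ k <= y) -> x = 0.

Section PositivelyHomogeneousCalculus.
Context {R : realType} {n : nat}.
Implicit Types h : 'rV[R]_n -> R.

Definition pos_homogeneous h :=
  forall (a : R) (x : 'rV[R]_n), 0 <= a -> h (a *: x) = a * h x.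

Definition Hspace : set ('rV[R]_n -> R) :=
  [set h | continuous h /\ pos_homogeneous h].

Definition symmetric_fun h :=
  forall (s : 'S_n) (x : 'rV[R]_n), h (\row_i x 0 (s i)) = h x.

Context {E : vectorLatticeType R}.

(* The relation h(f_1, ..., f_n) = g. *)
Definition hvalue h (f : 'rV[E]_n) (g : E) :=
  let S := generated_sublattice ([set f 0 i | i in setT] `|` [set g]) in
  forall w : E -> R, is_vl_hom_on S w -> nonzero_on S w ->
    h (map_mx w f) = w g.

End PositivelyHomogeneousCalculus.

Definition h_complete (R : realType) (E : vectorLatticeType R) (n : nat)
    (h : 'rV[R]_n -> R) :=
  forall f : 'rV[E]_n, exists g : E, hvalue h f g.

(* The function E^n -> E induced by h; the element g picked here is the only
   one satisfying hvalue h f g when E is Archimedean. *)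
Definition hmap (R : realType) (E : vectorLatticeType R) (n : nat)
    (h : 'rV[R]_n -> R) (hE : h_complete E h) (f : 'rV[E]_n) : E :=
  sval (cid (hE f)).

Definition pairwise_disjoint (R : realType) (E : vectorLatticeType R) (n : nat)
    (f : 'rV[E]_n) :=
  forall i j : 'I_n, i != j -> vmeet (f 0 i) (f 0 j) = 0.

(* A vector lattice has no least element in general; since the join is
   idempotent, starting the iteration at f_1 yields the supremum of
   f_1, ..., f_(n+1). *)
Definition bigsup (R : realType) (E : vectorLatticeType R) (n : nat)
    (f : 'rV[E]_n.+1) : E :=
  \big[vjoin/f 0 ord0]_(k < n.+1) f 0 k.

(* Main.v *)
(** In an Archimedean vector lattice, the real-valued lattice homomorphisms on a
    principal ideal separate its points: by Zorn's lemma the positive cone extends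
    to a meet-closed cone [Q] with [~ Q (- e)] which is maximal, hence contains [y]
    or [- y] for every [y], and then [y |-> sup {t | Q (y - t e)}] is a lattice
    homomorphism.  Applied to the ideal generated by the [f_i] and [h(f_1, ..., f_n)],
    this reduces (ii) => (i) to real vectors.  A homomorphism sends disjoint elements
    to a vector with at most one nonzero coordinate, so homogeneity and symmetry leave
    only [h (0, ..., 0, 1) = 1], which is (ii) evaluated at a homomorphism that does
    not vanish at [f]. *)
Require Import Defs.
From HB Require Import structures.
From mathcomp Require Import all_boot all_order all_algebra fingroup perm.
From mathcomp Require Import boolp classical_sets reals topology normedtype.
From mathcomp Require Import lra.
Import Order.TTheory GRing.Theory Num.Theory.
Import numFieldNormedType.Exports.
Local Open Scope classical_set_scope.
Local Open Scope ring_scope.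

Set Implicit Arguments.
Unset Strict Implicit.

Section VectorLatticeTheory.
Context {R : realType} {E : vectorLatticeType R}.
Implicit Types (x y z u v e : E) (a b c t : R) (P : set E) (w : E -> R).

(** * Order and lattice identities in a vector lattice *)

Lemma vlerDr z x y : (x + z <= y + z) = (x <= y).
Proof.
apply/idP/idP => [|]; last exact: vlerD2r.
by move/(@vlerD2r R E _ _ (- z)); rewrite !addrK.
Qed.

Lemma vlerDl z x y : (z + x <= z + y) = (x <= y).
Proof. by rewrite ![z + _]addrC vlerDr. Qed.

Lemma vlerD x y u v : x <= y -> u <= v -> x + u <= y + v.
Proof. by move=> xy uv; apply: (@le_trans _ _ (y + u)); rewrite ?vlerDr ?vlerDl. Qed.

Lemma vsubr_ge0 x y : (0 <= y - x) = (x <= y).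
Proof. by rewrite -(vlerDr x 0) add0r subrK. Qed.

Lemma vlerN x y : (- x <= - y) = (y <= x).
Proof. by rewrite -(vsubr_ge0 (- x)) opprK addrC vsubr_ge0. Qed.

Lemma vlerZl a b x : 0 <= x -> a <= b -> a *: x <= b *: x.
Proof.
move=> x0 ab; rewrite -vsubr_ge0 -scalerBl -(scaler0 _ (b - a)).
by apply: vlerZ; rewrite ?subr_ge0.
Qed.

Lemma vscaler_ge0 a x : 0 <= a -> 0 <= x -> 0 <= a *: x.
Proof. by move=> a0 x0; rewrite -(scaler0 _ a) vlerZ. Qed.

Lemma vle_joinl x y : x <= vjoin x y.
Proof. by have := lexx (vjoin x y); rewrite vleUx => /andP[]. Qed.

Lemma vle_joinr x y : y <= vjoin x y.
Proof. by have := lexx (vjoin x y); rewrite vleUx => /andP[]. Qed.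

Lemma vmeet_lel x y : vmeet x y <= x.
Proof. by have := lexx (vmeet x y); rewrite vlexI => /andP[]. Qed.

Lemma vmeet_ler x y : vmeet x y <= y.
Proof. by have := lexx (vmeet x y); rewrite vlexI => /andP[]. Qed.

Lemma vmeetD x y z : vmeet x y + z = vmeet (x + z) (y + z).
Proof.
apply/le_anti; rewrite vlexI !vlerDr vmeet_lel vmeet_ler /=.
by rewrite -(vlerDr (- z)) addrK vlexI -(vlerDr z) -[_ <= y](vlerDr z) subrK vmeet_lel vmeet_ler.
Qed.

Lemma vjoinNN x y : vjoin x y = - vmeet (- x) (- y).
Proof.
apply/le_anti/andP; split.
  by rewrite vleUx -vlerN opprK vmeet_lel -vlerN opprK vmeet_ler.
by rewrite -vlerN opprK vlexI !vlerN vle_joinl vle_joinr.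
Qed.

Lemma vmeetZ a x y : 0 < a -> vmeet (a *: x) (a *: y) = a *: vmeet x y.
Proof.
move=> a0; have a0' := ltW a0; have an0 : a != 0 by rewrite gt_eqF.
apply/le_anti/andP; split; last by rewrite vlexI !vlerZ ?vmeet_lel ?vmeet_ler.
rewrite -[leLHS](scalerKV (a := a)) //; apply: vlerZ => //.
by rewrite vlexI -{2}(scalerK an0 x) -{3}(scalerK an0 y) !vlerZ
  ?invr_ge0 ?vmeet_lel ?vmeet_ler.
Qed.

Definition vpos x := vjoin x 0.

Lemma vpos_ge0 x : 0 <= vpos x. Proof. exact: vle_joinr. Qed.

Lemma vle_pos x : x <= vpos x. Proof. exact: vle_joinl. Qed.

(** The decomposition of [x] into positive and negative parts, [vpos (- x)] being the negative
    part. *)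
Lemma vpos_posN x : vpos x = x + vpos (- x).
Proof.
apply/le_anti/andP; split.
  by rewrite vleUx -{1}[x]addr0 vlerDl vpos_ge0 -(vlerDl (- x)) addKr addr0 vle_pos.
rewrite -(vlerDl (- x)) addKr vleUx -{1}[- x]addr0 vlerDl vpos_ge0.
by rewrite -(vlerDl x) addr0 addNKr vle_pos.
Qed.

(** Pulling the common summand [vpos (- x)] out of the meet leaves [vmeet x 0 + vpos (- x)], and
    [vpos (- x)] is the opposite of [vmeet x 0]. *)
Lemma vpos_disjoint x : vmeet (vpos x) (vpos (- x)) = 0.
Proof.
rewrite (vpos_posN x) -[X in vmeet _ X]add0r -vmeetD.
by rewrite /vpos vjoinNN !opprK oppr0 subrr.
Qed.

(** For [b] at least [a] and [1], both [b *: u] and [b *: v] dominate [u], hence so does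
    [b *: vmeet u v], which is 0. *)
Lemma vdisjoint_dominated_eq0 a u v :
  0 <= u -> vmeet u v = 0 -> 0 <= v -> u <= a *: v -> u = 0.
Proof.
move=> u0 uv v0 uav; apply/le_anti; rewrite u0 andbT.
pose b := Num.max a 1; have b1 : 1 <= b by rewrite le_max lexx orbT.
have b0 : 0 < b by apply: lt_le_trans b1.
rewrite -(scaler0 _ b) -uv -vmeetZ // vlexI -{1}(scale1r u) vlerZl //=.
by rewrite (le_trans uav) ?vlerZl // le_max lexx.
Qed.

(** * The principal order ideal generated by a positive element *)

Definition order_bounded e : set E :=
  [set x | exists c, - (c *: e) <= x /\ x <= c *: e].

Lemma order_boundedP e x : 0 <= e -> order_bounded e x <->
  exists2 c, 0 <= c & - (c *: e) <= x /\ x <= c *: e.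
Proof.
move=> e0; split=> [[c [xl xr]]|[c _ xc]]; last by exists c.
exists (Num.max c 0); first by rewrite le_max lexx orbT.
have cc : c *: e <= Num.max c 0 *: e by rewrite vlerZl // le_max lexx.
by split; [apply: le_trans xl; rewrite vlerN|apply: le_trans cc].
Qed.

Lemma order_bounded_le e x : 0 <= x -> x <= e -> order_bounded e x.
Proof.
by move=> x0 xe; exists 1; rewrite scale1r; split=> //; apply: (le_trans _ x0);
  rewrite -oppr0 vlerN (le_trans x0).
Qed.

Lemma order_bounded_sublattice e : 0 <= e -> is_vector_sublattice (order_bounded e).
Proof.
move=> e0; have common x y : order_bounded e x -> order_bounded e y ->
    exists c, [/\ - (c *: e) <= x, x <= c *: e, - (c *: e) <= y & y <= c *: e].
  move=> [c [xl xr]] [d [yl yr]]; exists (Num.max c d).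
  have cm : c *: e <= Num.max c d *: e by rewrite vlerZl // le_max lexx.
  have dm : d *: e <= Num.max c d *: e by rewrite vlerZl // le_max lexx orbT.
  by split; [apply: le_trans xl; rewrite vlerN|apply: le_trans cm|
    apply: le_trans yl; rewrite vlerN|apply: le_trans dm].
split.
- by exists 0; rewrite scale0r oppr0.
- move=> x y /common/[apply] -[c [xl xr yl yr]]; exists (c + c).
  by rewrite scalerDl opprD !vlerD.
- move=> a x [c [xl xr]]; have [a0|a0] := leP 0 a.
    by exists (a * c); rewrite -scalerA -scalerN !vlerZ.
  have na0 : 0 <= - a by rewrite oppr_ge0 ltW.
  have -> : a *: x = - a *: - x by rewrite scaleNr scalerN opprK.
  exists (- a * c); rewrite -scalerA -scalerN; split; apply: vlerZ => //.
    by rewrite vlerN.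
  by rewrite -vlerN opprK.
- move=> x y /common/[apply] -[c [xl xr yl yr]]; exists c.
  by rewrite (le_trans xl (vle_joinl _ _)) vleUx xr yr.
- move=> x y /common/[apply] -[c [xl xr yl yr]]; exists c.
  by rewrite (le_trans (vmeet_lel _ _) xr) vlexI xl yl.
Qed.

(** * Meet-closed cones and their total extensions *)

(** When nonempty, such a [P] consists of the elements that are nonnegative modulo an order ideal,
    namely the intersection of [P] and its opposite. *)
Definition meet_cone P :=
  [/\ forall x y, P x -> P y -> P (x + y),
      forall a x, 0 <= a -> P x -> P (a *: x),
      forall x y, P x -> P y -> P (vmeet x y) &
      forall x y, P x -> x <= y -> P y].

Lemma meet_cone_ge0 P x y : meet_cone P -> P x -> 0 <= y -> P y.
Proof.
by move=> [_ PZ _ Pup] Px; apply: Pup; rewrite -(scale0r x); apply: PZ.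
Qed.

(* Forcing [y] to be nonnegative modulo an order ideal amounts to adding its
   negative part to the ideal. *)
Definition adjoin P y : set E :=
  [set z | exists2 a, 0 <= a & P (z + a *: vpos (- y))].

Lemma adjoin_cone P y : meet_cone P -> meet_cone (adjoin P y).
Proof.
move=> [PD PZ PI Pup]; have v0 := vpos_ge0 (- y); split.
- move=> x z [a a0 Px] [b b0 Pz]; exists (a + b); first exact: addr_ge0.
  by rewrite scalerDl addrACA; apply: PD.
- move=> b x b0 [a a0 Px]; exists (b * a); first exact: mulr_ge0.
  by rewrite -scalerA -scalerDr; apply: PZ.
(* The larger coefficient serves for both elements, so the same multiple is added to each and comes
   out of the meet. *)
- move=> x z [a a0 Px] [b b0 Pz]; exists (Num.max a b); first by rewrite le_max a0.
  rewrite vmeetD; apply: PI; [apply: Pup Px _|apply: Pup Pz _];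
    by rewrite vlerDl vlerZl // le_max lexx ?orbT.
- move=> x z [a a0 Px] xz; exists a => //.
  by apply: Pup Px _; rewrite vlerDr.
Qed.

Lemma sub_adjoin P y : P `<=` adjoin P y.
Proof. by move=> x Px; exists 0; rewrite // scale0r addr0. Qed.

Lemma adjoin_self P x y : meet_cone P -> P x -> adjoin P y y.
Proof.
move=> PC Px; exists 1; rewrite // scale1r -vpos_posN.
exact: meet_cone_ge0 PC Px (vpos_ge0 _).
Qed.

(** The two parts of [y] are disjoint, so [- e] is the meet of [- e + c *: vpos (- y)] and
    [- e + c *: vpos y], which both lie in [P] for large [c]. *)
Lemma adjoin_total P y e : meet_cone P ->
  adjoin P y (- e) -> adjoin P (- y) (- e) -> P (- e).
Proof.
move=> PC [a a0 Pa] [b b0]; rewrite opprK => Pb.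
have [_ _ PI Pup] := PC.
pose c := Num.max (Num.max a b) 1.
have c0 : 0 < c by rewrite (lt_le_trans ltr01) // le_max lexx orbT.
suff <- : vmeet (- e + c *: vpos (- y)) (- e + c *: vpos y) = - e.
  by apply: PI; [apply: Pup Pa _|apply: Pup Pb _];
    rewrite vlerDl vlerZl ?vpos_ge0 // !le_max lexx ?orbT.
rewrite ![- e + _]addrC -vmeetD vmeetZ // -{2}[y]opprK vpos_disjoint.
by rewrite scaler0 add0r.
Qed.

Lemma total_cone_extension P e : meet_cone P -> P !=set0 -> ~ P (- e) ->
  exists Q, [/\ meet_cone Q, P `<=` Q, ~ Q (- e) & forall y, Q y \/ Q (- y)].
Proof.
move=> PC P0 Pe.
(* Guarding by nonemptiness makes the empty set good, as the union of the empty chain requires. *)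
pose good Q := Q !=set0 -> [/\ meet_cone Q, P `<=` Q & ~ Q (- e)].
have [F Fgood Ftot|Q [Qgood Qmax]] := @Zorn_bigcup E good.
  move=> [z0 [X0 FX0 X0z0]].
  have Fg X x : F X -> X x -> [/\ meet_cone X, P `<=` X & ~ X (- e)].
    by move=> FX Xx; apply: (Fgood X FX); exists x.
  have both x y : (\bigcup_(X in F) X) x -> (\bigcup_(X in F) X) y ->
      exists X, [/\ F X, X x & X y].
    move=> [X FX Xx] [Y FY Yy]; have [XY|YX] := Ftot _ _ FX FY.
      by exists Y; split=> //; apply: XY.
    by exists X; split=> //; apply: YX.
  split.
  - split.
    + move=> x y /both/[apply] -[X [FX Xx Xy]]; exists X => //.
      by have [[XD _ _ _] _ _] := Fg _ _ FX Xx; apply: XD.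
    + move=> a x a0 [X FX Xx]; exists X => //.
      by have [[_ XZ _ _] _ _] := Fg _ _ FX Xx; apply: XZ.
    + move=> x y /both/[apply] -[X [FX Xx Xy]]; exists X => //.
      by have [[_ _ XI _] _ _] := Fg _ _ FX Xx; apply: XI.
    + move=> x y [X FX Xx] xy; exists X => //.
      by have [[_ _ _ Xup] _ _] := Fg _ _ FX Xx; apply: Xup xy.
  - by have [_ PX _] := Fg _ _ FX0 X0z0 => x /PX; exists X0.
  - by move=> [X FX Xe]; have [_ _] := Fg _ _ FX Xe; apply.
(* If the maximal set were empty, [P] would be a strictly larger good set. *)
have Qn0 : Q !=set0.
  apply: contrapT => Q0; apply: (Qmax P); [split=> [x Qx|PQ]|by move=> _; split].
    by case: Q0; exists x.
  by have [p Pp] := P0; case: Q0; exists p; apply: PQ.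
have [QC PQ Qe] := Qgood Qn0; have [q Qq] := Qn0.
exists Q; split=> // y.
(* Adjoining an element outside [Q] enlarges it strictly, so by maximality it can only fail to be
   good by containing [- e]. *)
have maxE z : ~ Q z -> adjoin Q z (- e).
  move=> Qz; apply: contrapT => Qze; apply: (Qmax (adjoin Q z)).
    split; first exact: sub_adjoin.
    by move=> sub; apply: Qz; apply: sub; apply: adjoin_self QC Qq.
  move=> _; split=> //; first exact: adjoin_cone.
  by apply: subset_trans PQ _; apply: sub_adjoin.
apply: contrapT => /not_orP[/maxE ? /maxE ?].
by apply: Qe; apply: (@adjoin_total _ y).
Qed.

(** * The homomorphism defined by a total meet-closed cone *)

Section ConeFunctional.
Variables (P : set E) (e : E).
Hypotheses (e_ge0 : 0 <= e) (P_cone : meet_cone P) (P_proper : ~ P (- e))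
  (P_total : forall y, P y \/ P (- y)).

Let Ee := order_bounded e.
Let PD x y : P x -> P y -> P (x + y). Proof. by case: P_cone => + _ _ _; apply. Qed.
Let PZ a x : 0 <= a -> P x -> P (a *: x).
Proof. by case: P_cone => _ + _ _; apply. Qed.
Let PI x y : P x -> P y -> P (vmeet x y). Proof. by case: P_cone => _ _ + _; apply. Qed.
Let Pup x y : P x -> x <= y -> P y. Proof. by case: P_cone => _ _ _; apply. Qed.
Let Pge0 x : 0 <= x -> P x.
Proof. by move=> x0; case: (P_total x) => // Px; apply: meet_cone_ge0 P_cone Px x0. Qed.

(** The Dedekind cut of [y] against the multiples of [e], in the total preorder whose nonnegative
    elements form [P]. *)
Definition cone_functional y := sup [set t | P (y - t *: e)].
Let w := cone_functional.

Let P_scaleN t : P (- (t *: e)) -> t <= 0.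
Proof.
move=> Pt; rewrite leNgt; apply/negP => t0; apply: P_proper.
have : P (t^-1 *: - (t *: e)) by apply: PZ; rewrite // invr_ge0 ltW.
by rewrite scalerN scalerK // gt_eqF.
Qed.

Let has_sup_cone y : Ee y -> has_sup [set t | P (y - t *: e)].
Proof.
move=> [c [yl yr]]; split.
  by exists (- c); apply: Pge0; rewrite vsubr_ge0 scaleNr.
exists c => t /= Pt; rewrite -subr_le0; apply: P_scaleN; apply: Pup Pt _.
by rewrite scalerBl opprB vlerDr.
Qed.

Let le_w y t : Ee y -> P (y - t *: e) -> t <= w y.
Proof. by move=> /has_sup_cone[_ ub]; apply: ub_le_sup. Qed.

Let lt_w y t : Ee y -> t < w y -> P (y - t *: e).
Proof.
move=> /has_sup_cone ys tw; have [s /= Ps ts] := sup_gt ys.1 tw.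
by apply: Pup Ps _; rewrite vlerDl vlerN vlerZl // ltW.
Qed.

(** The supremum need not be attained, so membership is only asked for [t < s]; the midpoint of
    [w y] and [s] gives the contradiction. *)
Let w_ge y s : Ee y -> (forall t, t < s -> P (y - t *: e)) -> s <= w y.
Proof.
move=> Ey Ps; rewrite leNgt; apply/negP => ws.
have := le_w Ey (Ps _ (midf_lt ws).2); rewrite leNgt.
by rewrite (midf_lt ws).1.
Qed.

(** Closure of [P] under sums gives superadditivity, and totality gives oddness; together they give
    additivity. Closure under meets gives the minimum, and the maximum follows by negation. *)
Lemma cone_functional_hom : is_vl_hom_on (order_bounded e) cone_functional.
Proof.
have [E0 ED EZ EU EI] := order_bounded_sublattice e_ge0.
have EN y : Ee y -> Ee (- y) by rewrite -scaleN1r; apply: EZ.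
have wsup x y : Ee x -> Ee y -> w x + w y <= w (x + y).
  move=> Ex Ey; apply: w_ge => [|t ts]; first exact: ED.
  (* Half of the slack between [t] and [w x + w y] goes to each summand. *)
  pose d := (w x + w y - t) / 2.
  have -> : x + y - t *: e = (x - (w x - d) *: e) + (y - (w y - d) *: e).
    rewrite addrACA -opprD -scalerDl; congr (_ - _ *: _).
    by rewrite /d; lra.
  by apply: PD; apply: lt_w => //; rewrite /d; lra.
have w0 : w 0 = 0.
  apply/le_anti/andP; split.
    rewrite leNgt; apply/negP => w0.
    have [m0 mw] := midf_lt w0.
    by have := lt_w E0 mw; rewrite sub0r => /P_scaleN; rewrite leNgt m0.
  by apply: le_w; rewrite // scale0r subr0; apply: Pge0.
have wN y : Ee y -> w (- y) = - w y.
  move=> Ey; have ENy := EN _ Ey; apply/le_anti/andP; split.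
    by have := wsup _ _ Ey ENy; rewrite subrr w0; lra.
  (* Otherwise totality puts [y + t *: e] in [P], so [- t <= w y], against [t < - w y]. *)
  apply: w_ge => // t tw; case: (P_total (- y - t *: e)) => //.
  rewrite opprB opprK addrC -[t]opprK scaleNr => /(le_w Ey); lra.
have wle x y : Ee x -> Ee y -> x <= y -> w x <= w y.
  move=> Ex Ey xy; apply: w_ge => // t /(lt_w Ex) Pt.
  by apply: Pup Pt _; rewrite vlerDr.
have wD x y : Ee x -> Ee y -> w (x + y) = w x + w y.
  move=> Ex Ey; apply/le_anti; rewrite wsup // andbT.
  (* Superadditivity at the opposites is subadditivity, by oddness. *)
  have := wsup _ _ (EN _ Ex) (EN _ Ey); rewrite -opprD !wN //; first by lra.
  exact: ED.
have wI x y : Ee x -> Ee y -> w (vmeet x y) = Num.min (w x) (w y).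
  move=> Ex Ey; have Exy := EI _ _ Ex Ey; apply/le_anti/andP; split.
    by rewrite le_min !wle ?vmeet_lel ?vmeet_ler.
  apply: w_ge => // t; rewrite lt_min => /andP[/(lt_w Ex) Px /(lt_w Ey) Py].
  by rewrite vmeetD; apply: PI.
have wZge a y : 0 < a -> Ee y -> a * w y <= w (a *: y).
  move=> a0 Ey; apply: w_ge => [|t]; first exact: EZ.
  rewrite mulrC -ltr_pdivrMr // => /(lt_w Ey)/(PZ (ltW a0)).
  by rewrite scalerBr scalerA mulrCA divff ?gt_eqF // mulr1.
have wZ0 a y : 0 <= a -> Ee y -> w (a *: y) = a * w y.
  rewrite le_eqVlt => /predU1P[<-|a0 Ey]; first by rewrite scale0r mul0r w0.
  apply/le_anti; rewrite wZge // andbT -ler_pdivrMl //.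
  (* The reverse inequality is [wZge] for the inverse scalar at [a *: y]. *)
  have := wZge a^-1 (a *: y); rewrite scalerK ?gt_eqF //.
  by apply; [rewrite invr_gt0|apply: EZ].
split=> //.
- move=> a y Ey; have [a0|a0] := leP 0 a; first exact: wZ0.
  rewrite -[a]opprK scaleNr [cone_functional _]wN; last exact: EZ.
  by rewrite wZ0 ?mulNr // oppr_ge0 ltW.
- move=> x y Ex Ey; rewrite vjoinNN [cone_functional _]wN.
    by rewrite wI ?wN ?oppr_min ?opprK //; apply: EN.
  by apply: EI; apply: EN.
Qed.

Lemma cone_functional_ge y t : order_bounded e y -> P (y - t *: e) ->
  t <= cone_functional y.
Proof. exact: le_w. Qed.

End ConeFunctional.

(** * Separation of points by homomorphisms *)

(** The Archimedean property gives [k] with [x *+ k] not below [e]. A total cone that makes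
    [x *+ k - e] nonnegative and excludes [- e] then yields a value of at least [k%:R^-1] at [x]. *)
Lemma positive_hom_exists e x : archimedean_vl E ->
  0 <= e -> 0 <= x -> order_bounded e x -> x != 0 ->
  exists2 w, is_vl_hom_on (order_bounded e) w & 0 < w x.
Proof.
move=> arch e0 x0 Ex xn0.
have [k kxe] : exists k, ~ (x *+ k <= e).
  apply: contrapT => /forallNP kx; move/eqP: xn0; apply.
  by apply: (arch x e) => // k; apply: contrapT; apply: kx.
pose y := x *+ k - e.
have posC : meet_cone [set z : E | 0 <= z].
  split=> [u v u0 v0|a u|u v u0 v0|u v u0 uv] /=.
  - by rewrite -[0]addr0; apply: vlerD.
  - exact: vscaler_ge0.
  - by rewrite vlexI u0.
  - exact: le_trans uv.
have [||Q [QC PQ Qe Qtot]] := total_cone_extension (P := adjoin [set z | 0 <= z] y) (e := e)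
    (adjoin_cone _ posC).
- by exists y; apply: (@adjoin_self _ 0) => //=.
(* Here [e <= a *: vpos (- y)], and [x] is below a multiple of [e], so [vpos y] is dominated by a
   multiple of the disjoint [vpos (- y)]. Hence it is 0 and [x *+ k <= e]. *)
- move=> [a a0] /=; rewrite addrC vsubr_ge0 => eav; apply: kxe.
  rewrite -vsubr_ge0 -oppr0 -vlerN opprB opprK -/y.
  have /(order_boundedP _ e0)[c c0 [_ xc]] := Ex.
  suff <- : vpos y = 0 by exact: vle_pos.
  apply: (@vdisjoint_dominated_eq0 (k%:R * c * a) _ (vpos (- y))) => //;
    rewrite ?vpos_ge0 ?vpos_disjoint //.
  rewrite vleUx; apply/andP; split; last first.
    by rewrite vscaler_ge0 ?vpos_ge0 ?mulr_ge0.
  apply: (@le_trans _ _ (k%:R *: x)).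
    by rewrite scaler_nat -[leRHS]addr0 vlerDl -oppr0 vlerN.
  by rewrite -!scalerA vlerZ ?ler0n // (le_trans xc) // vlerZ.
exists (cone_functional Q e); first exact: cone_functional_hom.
have Qy : Q y by apply: PQ; apply: (@adjoin_self _ 0) => //=.
have k0 : (0 < k)%N by rewrite lt0n; apply/eqP => k0; apply: kxe; rewrite k0.
apply: (@lt_le_trans _ _ k%:R^-1); first by rewrite invr_gt0 ltr0n.
apply: cone_functional_ge => //.
have [_ QZ _ _] := QC.
have k1 : 0 <= k%:R^-1 :> R by rewrite invr_ge0 ler0n.
(* Dividing [y] by [k] gives [x - k%:R^-1 *: e]. *)
have := QZ _ _ k1 Qy.
by rewrite /y scalerBr -(scaler_nat k x) scalerK // pnatr_eq0 -lt0n.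
Qed.

Definition vabs x := vjoin x (- x).

Lemma vabs_ge0 x : 0 <= vabs x.
Proof.
have yy : 0 <= vabs x + vabs x by rewrite -(subrr x) vlerD ?vle_joinl ?vle_joinr.
have -> : vabs x = 2^-1 *: (vabs x + vabs x).
  by rewrite -mulr2n -(scaler_nat 2 (vabs x)) scalerA mulVf ?scale1r ?pnatr_eq0.
by apply: vscaler_ge0; rewrite // invr_ge0.
Qed.

Lemma vabs_eq0 x : vabs x = 0 -> x = 0.
Proof.
move=> x0; apply/le_anti; rewrite -{1}x0 vle_joinl /=.
by rewrite -vlerN oppr0 -x0 vle_joinr.
Qed.

Lemma order_bounded_vabs e x : vabs x <= e -> order_bounded e x.
Proof.
move=> xe; exists 1; rewrite scale1r; split.
  by rewrite -vlerN opprK (le_trans _ xe) ?vle_joinr.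
by rewrite (le_trans _ xe) ?vle_joinl.
Qed.

(** A nonzero [vabs x] would have a positive image under some [w], but that image is the maximum of
    [w x] and [- w x]. *)
Lemma hom_separates e x : archimedean_vl E -> 0 <= e -> order_bounded e x ->
  (forall w, is_vl_hom_on (order_bounded e) w -> w x = 0) -> x = 0.
Proof.
move=> arch e0 Ex wx0; apply: vabs_eq0; apply/eqP; apply: contraT => xn0.
have [_ _ EZ EU _] := order_bounded_sublattice e0.
have ENx : order_bounded e (- x) by rewrite -scaleN1r; apply: EZ.
have [w wh] := positive_hom_exists arch e0 (vabs_ge0 x) (EU _ _ Ex ENx) xn0.
have [_ wZ wU _] := wh.
by rewrite /vabs wU // -scaleN1r wZ // wx0 // mulr0 maxxx ltxx.
Qed.

Lemma hom_eq e x y : archimedean_vl E -> 0 <= e ->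
  order_bounded e x -> order_bounded e y ->
  (forall w, is_vl_hom_on (order_bounded e) w -> w x = w y) -> x = y.
Proof.
move=> arch e0 Ex Ey wxy; apply/eqP; rewrite -subr_eq0; apply/eqP.
have [_ ED EZ _ _] := order_bounded_sublattice e0.
have ENy : order_bounded e (- 1 *: y) by apply: EZ.
rewrite -scaleN1r; apply: (hom_separates arch e0); first exact: ED.
move=> w wh; have [wD wZ _ _] := wh.
by rewrite wD // wZ // (wxy _ wh) mulN1r subrr.
Qed.

(** * Functional calculus and finite suprema under homomorphisms *)

Lemma vl_hom0 (S : set E) w : is_vector_sublattice S -> is_vl_hom_on S w -> w 0 = 0.
Proof. by move=> [S0 _ _ _ _] [_ wZ _ _]; rewrite -(scale0r 0) wZ // mul0r. Qed.

Lemma vl_hom_ge0 (S : set E) w x : is_vector_sublattice S -> is_vl_hom_on S w ->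
  S x -> 0 <= x -> 0 <= w x.
Proof.
move=> SL wh Sx x0; have [S0 _ _ _ _] := SL; have [_ _ wU _] := wh.
have <- : vjoin x 0 = x by apply/le_anti; rewrite vleUx lexx x0 vle_joinl.
by rewrite wU // (vl_hom0 SL wh) le_max lexx orbT.
Qed.

(** Restriction to the generated sublattice reduces this to [hvalue], unless [w] vanishes there;
    then both sides are 0, as homogeneity forces [h 0 = 0]. *)
Lemma hvalue_hom n (h : 'rV[R]_n -> R) (f : 'rV[E]_n) (g : E) (S : set E) w :
  pos_homogeneous h -> is_vector_sublattice S -> is_vl_hom_on S w ->
  (forall i, S (f 0 i)) -> S g -> hvalue h f g -> h (map_mx w f) = w g.
Proof.
move=> hZ SL [wD wZ wU wI] Sf Sg hfg.
set A := [set f 0 i | i in setT] `|` [set g].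
have genS : generated_sublattice A `<=` S.
  by move=> x; apply; split=> // y [[i _ <-]|->].
have Agen : A `<=` generated_sublattice A by move=> x Ax B [_]; apply.
have [wn0|w0] := pselect (nonzero_on (generated_sublattice A) w).
  by apply: hfg => //; split=> *; [apply: wD|apply: wZ|apply: wU|apply: wI];
    apply: genS.
have wA0 x : A x -> w x = 0.
  move=> Ax; apply/eqP; apply: contraT => wx; case: w0.
  by exists x => //; apply: Agen.
rewrite [RHS]wA0; last by right.
have -> : map_mx w f = 0 *: 0.
  by apply/rowP => i; rewrite scale0r !mxE wA0 //; left; exists i.
by rewrite hZ // mul0r.
Qed.

Lemma bigsup_le n (f : 'rV[E]_n.+1) z :
  (bigsup f <= z) = [forall k, f 0 k <= z].
Proof.
rewrite /bigsup; apply/idP/forallP => [+ k|fz].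
  have : k \in index_enum 'I_n.+1 by rewrite mem_index_enum.
  elim: (index_enum _) => [//|j s IHs].
  rewrite inE big_cons vleUx => /predU1P[->|ks] /andP[//].
  by move=> _; apply: IHs.
by elim/big_ind: _ => // x y xz yz; rewrite vleUx xz.
Qed.

Lemma le_bigsup n (f : 'rV[E]_n.+1) k : f 0 k <= bigsup f.
Proof. by have := lexx (bigsup f); rewrite bigsup_le => /forallP. Qed.

Lemma hom_bigsup n (f : 'rV[E]_n.+1) (S : set E) w : is_vector_sublattice S ->
  is_vl_hom_on S w -> (forall i, S (f 0 i)) ->
  w (bigsup f) = \big[Num.max/w (f 0 ord0)]_k w (f 0 k).
Proof.
move=> [_ _ _ SU _] [_ _ wU _] Sf.
(* Membership in [S] goes along with the induction, since [w] is known to preserve joins only on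
   [S]. *)
suff [] : S (bigsup f) /\ w (bigsup f) = \big[Num.max/w (f 0 ord0)]_k w (f 0 k).
  by [].
rewrite /bigsup; elim/big_rec2: _ => [//|k a x _ [Sx <-]].
by split; [apply: SU|apply: wU].
Qed.

End VectorLatticeTheory.

(** * Symmetric homogeneous functions on disjoint real vectors *)

Section Symmetric.
Context {R : realType} {n : nat}.
Implicit Types (h : 'rV[R]_n.+1 -> R) (v : 'rV[R]_n.+1).

Lemma symmetric_delta h i j : symmetric_fun h -> h (delta_mx 0 i) = h (delta_mx 0 j).
Proof.
move=> h_sym; rewrite -(h_sym (tperm i j)); congr h; apply/rowP => k.
by rewrite !mxE -[k == j](inj_eq (@perm_inj _ (tperm i j))) tpermR.
Qed.

Lemma disjoint_vector v : (forall i, 0 <= v 0 i) ->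
  (forall i j, i != j -> Num.min (v 0 i) (v 0 j) = 0) ->
  exists i, v = v 0 i *: delta_mx 0 i.
Proof.
move=> v0 vd; have [[i vi]|vn] := pselect (exists i, 0 < v 0 i); last first.
  have vE k : v 0 k = 0.
    apply/le_anti; rewrite v0 andbT leNgt; apply/negP => vk.
    by apply: vn; exists k.
  (* For the zero vector any index will do. *)
  by exists ord0; apply/rowP => j; rewrite !mxE !vE mul0r.
exists i; apply/rowP => j; rewrite !mxE eqxx.
have [->|ji] := eqVneq j i; first by rewrite mulr1.
have := vd _ _ ji; rewrite mulr0; case: leP => // _ vi0.
by rewrite vi0 ltxx in vi.
Qed.

(** The vector is a nonnegative multiple of one basis vector; homogeneity extracts the factor, which
    is also the largest coordinate, and symmetry moves the index to the last one. *)
Lemma symmetric_disjoint h v : pos_homogeneous h -> symmetric_fun h ->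
  h (delta_mx 0 ord_max) = 1 -> (forall i, 0 <= v 0 i) ->
  (forall i j, i != j -> Num.min (v 0 i) (v 0 j) = 0) ->
  h v = \big[Num.max/v 0 ord0]_k v 0 k.
Proof.
move=> hZ h_sym h1 v0 vd; have [i vE] := disjoint_vector v0 vd.
rewrite {1}vE hZ // (symmetric_delta _ ord_max h_sym) h1 mulr1.
have vle j : v 0 j <= v 0 i.
  by rewrite {1}vE !mxE eqxx ler_piMr // lern1 leq_b1.
apply/le_anti; rewrite le_bigmax //=.
by apply: bigmax_le => // j _; apply: vle.
Qed.

End Symmetric.

Theorem corollary3p8 (R : realType) (E : vectorLatticeType R)
  (E_nontrivial : exists x : E, x != 0)
  (E_archimedean : archimedean_vl E)
  (n : nat) (h : 'rV[R]_n.+1 -> R)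
  (h_H : Hspace h) (h_sym : symmetric_fun h)
  (hE : h_complete E h) :
  (forall f : 'rV[E]_n.+1, (forall i, 0 <= f 0 i) -> pairwise_disjoint f ->
     hmap hE f = bigsup f)
  <->
  (forall f : E, 0 <= f ->
     hmap hE (\row_(i < n.+1) (if i == ord_max then f else 0)) = f).
Proof.
have [_ hZ] := h_H.
split=> [hsup f f0|hlast].
  (* The vector with last entry [f] and zeros elsewhere is positive and pairwise disjoint, with
     supremum [f]. *)
  set F := \row_i _.
  have F0 i : 0 <= F 0 i by rewrite mxE; case: ifP.
  rewrite hsup //.
    apply/le_anti/andP; split.
      by rewrite bigsup_le; apply/forallP => k; rewrite mxE; case: ifP.
    by have := le_bigsup F ord_max; rewrite {1}mxE eqxx.
  move=> i j ij; apply/le_anti; rewrite vlexI !F0 !andbT !mxE.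
  case: (eqVneq i ord_max) ij => [->|_ _] /=; last exact: vmeet_lel.
  by rewrite eq_sym => /negPf ->; apply: vmeet_ler.
(* Evaluate (ii) at a homomorphism with [w f > 0], where [f] is the absolute value of a nonzero
   element, and cancel [w f]. *)
have h1 : h (delta_mx 0 ord_max) = 1.
  have [x xn0] := E_nontrivial; pose f := vabs x; have f0 := vabs_ge0 x : 0 <= f.
  have fn0 : f != 0 by apply: contra xn0 => /eqP/vabs_eq0 ->.
  have Ef : order_bounded f f by apply: order_bounded_le.
  have fL := order_bounded_sublattice f0.
  have [w wh wf] := positive_hom_exists E_archimedean f0 f0 Ef fn0.
  set F : 'rV[E]_n.+1 := \row_(i < n.+1) (if i == ord_max then f else 0).
  have hF : hvalue h F f by rewrite -[X in hvalue _ _ X](hlast f f0); apply: svalP (cid (hE F)).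
  have := hvalue_hom hZ fL wh _ Ef hF.
  have -> : map_mx w F = w f *: delta_mx 0 ord_max.
    apply/rowP => i; rewrite !mxE; case: ifP => _; rewrite ?mulr1 //.
    by rewrite (vl_hom0 fL wh) mulr0.
  rewrite hZ ?ltW // => hw; apply: (mulfI (lt0r_neq0 wf)); rewrite mulr1.
  by apply: hw => i; rewrite mxE; case: ifP => // _; case: fL.
move=> f f0 fd; set g := hmap hE f.
have hg : hvalue h f g := svalP (cid (hE f)).
(* This [e] dominates every [f 0 i] and [vabs g], so one principal ideal contains both sides of the
   equation. *)
pose e := bigsup f + vabs g.
have sup0 : 0 <= bigsup f := le_trans (f0 ord0) (le_bigsup f ord0).
have supe : bigsup f <= e by rewrite -[leLHS]addr0 vlerDl vabs_ge0.
have e0 : 0 <= e := le_trans sup0 supe.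
have eL := order_bounded_sublattice e0.
have Ef i : order_bounded e (f 0 i).
  by apply: order_bounded_le => //; apply: le_trans (le_bigsup f i) supe.
have Eg : order_bounded e g.
  by apply: order_bounded_vabs; rewrite -[leLHS]add0r vlerDr.
apply: (hom_eq E_archimedean e0 Eg); first exact: order_bounded_le.
move=> w wh; rewrite -(hvalue_hom hZ eL wh Ef Eg hg) (hom_bigsup eL wh Ef).
rewrite symmetric_disjoint //.
- by rewrite mxE; apply: eq_bigr => k _; rewrite mxE.
- by move=> i; rewrite mxE (vl_hom_ge0 eL wh).
- move=> i j ij; rewrite !mxE; have [_ _ _ wI] := wh.
  by rewrite -wI // fd // (vl_hom0 eL wh).
Qed.
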